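(* Let $\mathfrak{g}$ be a finite-dimensional Lie algebra over the field $\mathbb{C}$ of complex numbers and $\langle\cdot,\cdot\rangle$ a nil-invariant symmetric ($\mathbb{C}$-)bilinear form on $\mathfrak{g}$. Then $\langle\cdot,\cdot\rangle$ is invariant, that is, $\langle[X,Y],Z\rangle=-\langle Y,[X,Z]\rangle$ for all $X,Y,Z\in\mathfrak{g}$.
   Context: A symmetric bilinear form $\langle\cdot,\cdot\rangle$ (possibly degenerate) on $\mathfrak{g}$ is nil-invariant if every nilpotent operator $\varphi$ in the smallest algebraic Lie subalgebra of $\mathfrak{gl}(\mathfrak{g})$ containing $\mathrm{ad}(\mathfrak{g})$ (i.e. in the Lie algebra of the Zariski closure of the adjoint group $\mathrm{Inn}(\mathfrak{g})$ in $\mathrm{Aut}(\mathfrak{g})$) is skew: $\langle\varphi X_1,X_2\rangle=-\langle X_1,\varphi X_2\rangle$ for all $X_1,X_2\in\mathfrak{g}$. *)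

(* Defs.v *)
From mathcomp Require Import all_boot all_order all_algebra.
From mathcomp Require Import sesquilinear.
From mathcomp Require Import mpoly.
From mathcomp Require Import complex reals.

Set Implicit Arguments.
Unset Strict Implicit.
Unset Printing Implicit Defensive.

Import GRing.Theory.
Local Open Scope ring_scope.

Section LinearAlgebraicGroups.
Variables (K : fieldType) (V : vectType K).

(* Polynomials on the vector space End(V), in the coordinates of the basis    *)
(* chosen by the library; none of the notions below depends on that choice.   *)
Definition end_poly := {mpoly K[\dim {:'End(V)}]}.

Definition end_coord (a : 'End(V)) : 'I_(\dim {:'End(V)}) -> K :=
  fun i => coord (vbasis {:'End(V)}) i a.

Definition in_GL (a : 'End(V)) : Prop := lker a = 0%VS.

(* A closed subset of GL(V), the open set det != 0 of End(V), is the trace on *)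
(* GL(V) of a closed subset of End(V): polynomials in the coordinates and     *)
(* 1/det define the same closed sets as polynomials in the coordinates.       *)
Definition zariski_closed_in_GL (G : 'End(V) -> Prop) : Prop :=
  exists I : end_poly -> Prop, forall a : 'End(V),
    G a <-> in_GL a /\ (forall p, I p -> p.@[end_coord a] = 0).

(* An algebraic group is identified with its K-points; this is the classical  *)
(* notion for K algebraically closed.                                         *)
Definition algebraic_group (G : 'End(V) -> Prop) : Prop :=
  [/\ zariski_closed_in_GL G,
      G \1%VF,
      forall a b, G a -> G b -> G (a \o b)%VF
    & forall a, G a -> G (a^-1)%VF].

(* The tangent space of G at the identity: the X in gl(V) = End(V) that       *)
(* annihilate the differential at 1 of every polynomial vanishing on G.       *)
Definition lie_of_group (G : 'End(V) -> Prop) (X : 'End(V)) : Prop :=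
  forall p : end_poly, (forall a, G a -> p.@[end_coord a] = 0) ->
    \sum_i (p^`M(i)).@[end_coord \1%VF] * end_coord X i = 0.

Definition algebraic_lie_subalgebra (h : 'End(V) -> Prop) : Prop :=
  exists2 G, algebraic_group G & forall X, h X <-> lie_of_group G X.

(* The smallest algebraic Lie subalgebra of gl(V) containing S, as the        *)
(* intersection of all of them. In characteristic 0 this intersection is      *)
(* itself algebraic, because Lie(G) :&: Lie(H) = Lie(G :&: H).                *)
Definition algebraic_hull (S : 'End(V) -> Prop) (phi : 'End(V)) : Prop :=
  forall h, algebraic_lie_subalgebra h -> (forall X, S X -> h X) -> h phi.

Definition nilpotent_end (phi : 'End(V)) : Prop :=
  exists k : nat, forall x, iter k phi x = 0.

End LinearAlgebraicGroups.

Section LieAlgebras.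
Variables (K : fieldType) (g : vectType K).

Definition is_lie_bracket (br : {bilinear g -> g -> g}) : Prop :=
  (forall x, br x x = 0) /\
  (forall x y z, br x (br y z) + br y (br z x) + br z (br x y) = 0).

Definition ad (br : {bilinear g -> g -> g}) (x : g) : 'End(g) := linfun (br x).

Definition is_symmetric_form (B : {biscalar g}) : Prop :=
  forall x y, B x y = B y x.

Definition is_nil_invariant (br : {bilinear g -> g -> g}) (B : {biscalar g}) :=
  forall phi : 'End(g),
    algebraic_hull (fun a => exists x, a = ad br x) phi ->
    nilpotent_end phi ->
    forall x y, B (phi x) y = - B x (phi y).

Definition is_invariant_form (br : {bilinear g -> g -> g}) (B : {biscalar g}) :=
  forall x y z, B (br x y) z = - B y (br x z).

End LieAlgebras.

(* Main.v *)
Require Import Defs.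
From HB Require Import structures.
From mathcomp Require Import all_boot all_order all_algebra.
From mathcomp Require Import sesquilinear mpoly.
From mathcomp Require Import complex reals boolp.

(* Fix x, put f = ad x and let V_a be its generalised eigenspaces. For y in   *)
(* V_a with a != 0, ad y is nilpotent, hence skew for B. As f is invertible   *)
(* on V_a, every v in V_a is [x, w] with w in V_a, and skewness of ad w gives *)
(* B x v = - B x v. Then B [x, w] v = B x [w, v] for w in V_a and v in V_b    *)
(* shows that V_a and V_b are orthogonal when a + b != 0. Thus the semisimple *)
(* part of f is skew. The nilpotent part of f lies in the algebraic hull of   *)
(* ad g, so it is skew by hypothesis, and f is skew.                          *)
(*                                                                            *)
(* That Lie(G) contains the Jordan components of its elements X is a theorem  *)
(* of Chevalley: the ideal of G is stable under the derivation D_X attached   *)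
(* to right translation by X. With S the semisimple part of X, polynomials    *)
(* are sums of eigenvectors of D_S that are generalised eigenvectors of D_X   *)
(* for the same eigenvalue, so D_S acts on each polynomial as a polynomial in *)
(* D_X and preserves the ideal.                                               *)

Set Implicit Arguments.
Unset Strict Implicit.
Unset Printing Implicit Defensive.

Import GRing.Theory.
Local Open Scope ring_scope.

(** Write [ad br x] as S + N, with S semisimple and N nilpotent, both polynomials in [ad br x];
    invariance of [B] is skewness of both parts. For N it is the hypothesis, applied through
    [nilpotent_part] and [algebraic_hull_nilpotent_part]; the latter rests on
    [lie_of_group_semisimple], which combines [vanishes_rderiv] with [weight_sum_pact]. Since S is
    the scalar a on V_a, its skewness says that (a + b) B(u, v) = 0 for u in V_a and v in V_b: this
    is [form_weight], obtained from [ad_weight_nilpotent] and [form_self_weight]. *)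

(** * Polynomials in a linear operator and generalised eigenvectors *)

Section PolyAction.
Variables (K : fieldType) (W : lmodType K).
Implicit Types (D : {linear W -> W}) (p q : {poly K}) (v w : W).

(** This is p(D) v. Iterates make sense on any module, so that [V], 'End(V) and the
    infinite-dimensional ring [end_poly V] are treated alike. *)
Definition pact D p v : W := \sum_(i < size p) p`_i *: iter i D v.

Lemma pactE D n p v : (size p <= n)%N ->
  pact D p v = \sum_(i < n) p`_i *: iter i D v.
Proof.
move=> le_pn.
rewrite /pact (big_ord_widen _ (fun i => p`_i *: iter i D v) le_pn) big_mkcond.
apply: eq_bigr => i _; case: ltnP => // le_pi.
by rewrite nth_default // scale0r.
Qed.

Lemma iter_is_linear D k : linear (iter k D).
Proof. by elim: k => // k IH a v w; rewrite /= IH linearP. Qed.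

Lemma pact_is_linear D p : linear (pact D p).
Proof.
move=> a v w; rewrite /pact scaler_sumr -big_split; apply: eq_bigr => i _.
by rewrite iter_is_linear scalerDr !scalerA mulrC.
Qed.

HB.instance Definition _ D p :=
  GRing.isLinear.Build K W W *:%R (pact D p) (@pact_is_linear D p).

Lemma pactD D p q v : pact D (p + q) v = pact D p v + pact D q v.
Proof.
have le_p := leq_maxl (size p) (size q).
have le_q := leq_maxr (size p) (size q).
rewrite (pactE D v le_p) (pactE D v le_q) (pactE D v (size_polyD p q)).
by rewrite -big_split; apply: eq_bigr => i _; rewrite coefD scalerDl.
Qed.

Lemma pactC D c v : pact D c%:P v = c *: v.
Proof. by rewrite (pactE D v (size_polyC_leq1 c)) big_ord1 coefC. Qed.

Lemma pactN D p v : pact D (- p) v = - pact D p v.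
Proof.
rewrite /pact size_polyN -sumrN; apply: eq_bigr => i _.
by rewrite coefN scaleNr.
Qed.

Lemma pactMX D p v : pact D (p * 'X) v = pact D p (D v).
Proof.
have le_pX : (size (p * 'X)%R <= (size p).+1)%N.
  by rewrite (leq_trans (size_polyMleq _ _)) // size_polyX addn2.
rewrite (pactE D v le_pX) big_ord_recl coefMX scale0r add0r.
by apply: eq_bigr => i _; rewrite coefMX /= -iterS iterSr.
Qed.

Lemma pactM D p q v : pact D (p * q) v = pact D p (pact D q v).
Proof.
elim/poly_ind: q v => [|q c IH] v.
  by rewrite mulr0 -[0]/(0%:P) !pactC scale0r linear0.
rewrite mulrDr mulrA !pactD !pactMX IH linearD /=; congr (_ + _).
rewrite mulrC pactC linearZ /= mul_polyC /pact.
have le_cp : (size (c *: p) <= size p)%N by exact: size_scale_leq.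
rewrite -/(pact _ _ _) (pactE D v le_cp) scaler_sumr.
by apply: eq_bigr => i _; rewrite coefZ scalerA.
Qed.

Lemma pact_commute D p q v : pact D p (pact D q v) = pact D q (pact D p v).
Proof. by rewrite -!pactM mulrC. Qed.

Lemma pactXsubC D a v : pact D ('X - a%:P) v = D v - a *: v.
Proof.
rewrite pactD pactN pactC -['X]mul1r pactMX -[1]/(1%:P) pactC.
by rewrite scale1r.
Qed.

Lemma pact1 D v : pact D 1 v = v.
Proof. by rewrite -[1]/(1%:P) pactC scale1r. Qed.

Lemma pact_sum D (I : Type) (s : seq I) (F : I -> {poly K}) v :
  pact D (\sum_(i <- s) F i) v = \sum_(i <- s) pact D (F i) v.
Proof.
elim: s => [|i s IH]; first by rewrite !big_nil -[0]/(0%:P) pactC scale0r.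
by rewrite !big_cons pactD IH.
Qed.

Lemma pact_dvdp D p q v : p %| q -> pact D p v = 0 -> pact D q v = 0.
Proof. by case/dvdpP=> r ->; rewrite pactM => ->; rewrite linear0. Qed.

Lemma pact_coprimep D p q v :
  coprimep p q -> pact D p v = 0 -> pact D q v = 0 -> v = 0.
Proof.
move=> /Bezout_eq1_coprimepP [[a b] /= ab1] pv qv.
by rewrite -[v](pact1 D) -ab1 pactD !pactM pv qv !linear0 addr0.
Qed.

(* v lies in the generalised eigenspace of D for a (possibly v = 0).          *)
Definition weight D a v := exists k, pact D (('X - a%:P) ^+ k) v = 0.

Lemma weight_pact D a p v : weight D a v -> weight D a (pact D p v).
Proof. by move=> [k vk]; exists k; rewrite pact_commute vk linear0. Qed.

(** A Bezout relation between ['X] and a power of ['X - a%:P] writes [v] as D(u(D) v). *)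
Lemma weight_invertible D a v : a != 0 -> weight D a v ->
  exists2 w, weight D a w & v = D w.
Proof.
move=> a0 [k vk].
have : coprimep 'X (('X - a%:P) ^+ k).
  by apply: coprimep_expr; rewrite coprimep_XsubC rootX.
move=> /Bezout_eq1_coprimepP [[u w] /= uw1].
exists (pact D u v); first by apply: weight_pact; exists k.
rewrite -[LHS](pact1 D) -uw1 pactD [pact D (w * _) v]pactM vk linear0 addr0.
by rewrite mulrC pactM -['X]subr0 pactXsubC scale0r subr0.
Qed.

End PolyAction.

(** By the Leibniz rule, [D3 - (a + b)] sends [mul u v] to the sum of [mul ((D1 - a) u) v] and
    [mul u ((D2 - b) v)], and either term lowers [k + l]. It serves for Lie brackets and for
    products of polynomials. *)
Lemma weight_mul (K : fieldType) (W1 W2 W3 : lmodType K)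
    (D1 : {linear W1 -> W1}) (D2 : {linear W2 -> W2}) (D3 : {linear W3 -> W3})
    (mul : {bilinear W1 -> W2 -> W3}) a b u v :
  (forall u v, D3 (mul u v) = mul (D1 u) v + mul u (D2 v)) ->
  weight D1 a u -> weight D2 b v -> weight D3 (a + b) (mul u v).
Proof.
move=> leibniz [k uk] [l vl]; exists (k + l)%N.
move: {2}(k + l)%N (leqnn (k + l)) => n.
elim: n k l u v uk vl => [|n IH] [|k] [|l] u v uk vl le_kl;
  rewrite ?expr0 ?pact1 in uk vl; rewrite ?uk ?vl ?linear0l ?linear0r ?linear0 //.
have -> : pact D3 (('X - (a + b)%:P) ^+ (k.+1 + l.+1)) (mul u v)
    = pact D3 (('X - (a + b)%:P) ^+ (k + l.+1)) (mul (D1 u - a *: u) v)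
    + pact D3 (('X - (a + b)%:P) ^+ (k.+1 + l)) (mul u (D2 v - b *: v)).
  rewrite [(k.+1 + l)%N]addSnnS addSn exprSr pactM pactXsubC leibniz.
  rewrite -(linearD (pact D3 _)).
  rewrite linearBl linearBr linearZl_LR linearZr_LR /= scalerDl.
  by congr pact; rewrite addrACA opprD.
have -> : pact D3 (('X - (a + b)%:P) ^+ (k + l.+1)) (mul (D1 u - a *: u) v) = 0.
  by apply: IH => //; rewrite -pactXsubC -pactM -exprSr.
rewrite add0r; apply: IH => //; first by rewrite -pactXsubC -pactM -exprSr.
by rewrite addSnnS.
Qed.

(** * Chinese remainders and the Jordan decomposition *)

Lemma coprimep_XsubC_exp (K : fieldType) (a b : K) k l :
  a != b -> coprimep (('X - a%:P) ^+ k) (('X - b%:P) ^+ l).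
Proof.
move=> ab; apply/coprimep_expl/coprimep_expr/coprimep_XsubC2.
by rewrite subr_eq0 eq_sym.
Qed.

Lemma coprimep_XsubC_exp_prod (K : fieldType) (a : K) (s : seq K) m :
  a \notin s -> coprimep (('X - a%:P) ^+ m) (\prod_(z <- s) ('X - z%:P) ^+ m).
Proof.
elim: s => [|z s IH]; first by rewrite big_nil coprimep1.
rewrite inE negb_or big_cons coprimepMr => /andP [az /IH ->]; rewrite andbT.
exact: coprimep_XsubC_exp.
Qed.

Lemma poly_chinese (K : fieldType) (s : seq K) m (r : K -> {poly K}) :
  exists Q, forall z, z \in s -> ('X - z%:P) ^+ m %| Q - r z.
Proof.
elim: s => [|a s [Q hQ]]; first by exists 0.
have [sa|nsa] := boolP (a \in s).
  by exists Q => z; rewrite inE => /predU1P [->|]; apply: hQ.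
pose M := \prod_(z <- s) ('X - z%:P) ^+ m.
have cop : coprimep (('X - a%:P) ^+ m) M by apply: coprimep_XsubC_exp_prod.
have /Bezout_eq1_coprimepP [[u w] /= uw1] := cop.
(* [M * w] is 1 modulo the new power and 0 modulo the old ones, so the correction acts at [a]
   only. *)
exists (Q + M * w * (r a - Q)) => z; rewrite inE => /predU1P [->|sz].
  have -> : Q + M * w * (r a - Q) - r a = (1 - w * M) * (Q - r a).
    by rewrite mulrBl mul1r [w * M]mulrC -[r a - Q]opprB mulrN addrAC.
  by rewrite -uw1 addrK mulrAC dvdp_mulIr.
rewrite addrAC dvdp_add ?hQ //.
rewrite -mulrA dvdp_mulr // /M (big_rem z) //=; exact: dvdp_mulIl.
Qed.

(** The [P z], evaluated at [D], cut each vector into generalised eigenvectors; [Q], evaluated at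
    [D], is the semisimple part of [D]. *)
Record weight_split (K : fieldType) (W : lmodType K) (D : {linear W -> W})
    (s : seq K) (P : K -> {poly K}) (Q : {poly K}) (m : nat) : Prop :=
  WeightSplit {
  split_sum : forall v, \sum_(z <- s) pact D (P z) v = v;
  split_exp : forall z v, z \in s ->
    pact D (('X - z%:P) ^+ m) (pact D (P z) v) = 0;
  split_semisimple : forall z v, z \in s ->
    pact D Q (pact D (P z) v) = z *: pact D (P z) v }.

(* P and Q depend on the annihilating polynomial only, so that the same ones  *)
(* split an endomorphism X and the left multiplication by X.                  *)
Lemma weight_split_exists (K : fieldType) (t : seq K) : exists s P Q m,
  forall (W : lmodType K) (D : {linear W -> W}),
    (forall v, pact D (\prod_(z <- t) ('X - z%:P)) v = 0) ->
    weight_split D s P Q m.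
Proof.
(* [size t] bounds the multiplicity of each root, so the product over [t] divides [M]. *)
pose s := undup t; pose m := size t.
pose M := \prod_(z <- s) ('X - z%:P) ^+ m.
have /choice [P hP] : forall a, exists p, forall z, z \in s ->
    ('X - z%:P) ^+ m %| p - (z == a)%:R%:P.
  by move=> a; apply: poly_chinese.
have [Q hQ] := poly_chinese s m (fun z => z%:P).
exists s, P, Q, m => W D kill.
have killM q v : (forall z, z \in s -> ('X - z%:P) ^+ m %| q) -> pact D q v = 0.
  move=> dvd; apply: (@pact_dvdp _ _ D (\prod_(z <- t) ('X - z%:P))) => //.
  apply: (@dvdp_trans _ M); last first.
    rewrite /M; have : uniq s by apply: undup_uniq.
    elim: (s) dvd => [|a l IH] dvd; first by rewrite big_nil dvd1p.
    rewrite big_cons => /= /andP [al ul].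
    rewrite Gauss_dvdp ?coprimep_XsubC_exp_prod //.
    rewrite dvd ?mem_head //= IH // => z zl.
    by rewrite dvd // inE zl orbT.
  rewrite /M /m prodrXl.
  have : {subset t <= s} by move=> z; rewrite mem_undup.
  elim: (t) => [|a l IH] sub; first by rewrite big_nil dvd1p.
  rewrite big_cons exprS dvdp_mul //; last first.
    by apply: IH => z zl; apply: sub; rewrite inE zl orbT.
  by rewrite (big_rem a) ?sub ?mem_head //= dvdp_mulIl.
split.
- move=> v; rewrite -pact_sum; apply/eqP; rewrite -subr_eq0 -{2}[v](pact1 D).
  rewrite -pactN -pactD; apply/eqP/killM => z zs.
  have -> : \sum_(a <- s) P a - 1 = \sum_(a <- s) (P a - (z == a)%:R%:P).
    rewrite sumrB; congr (_ - _).
    rewrite (bigD1_seq z) ?undup_uniq //= eqxx big1 ?addr0 // => a.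
    by rewrite eq_sym => /negbTE ->.
  apply: (big_ind (fun p => ('X - z%:P) ^+ m %| p)) => [|p q|a _].
  - exact: dvdp0.
  - exact: dvdp_add.
  - exact: hP.
- move=> z v zs; rewrite -pactM; apply: killM => a sa.
  have [->|az] := eqVneq a z; first exact: dvdp_mulIl.
  by rewrite dvdp_mull //; have := hP z a sa; rewrite (negbTE az) subr0.
- move=> z v zs; apply/eqP; rewrite -subr_eq0 -[z *: _](pactC D) -pactN -pactD.
  rewrite -pactM; apply/eqP/killM => a sa.
  have [->|az] := eqVneq a z; first by rewrite dvdp_mulr // hQ.
  by rewrite dvdp_mull //; have := hP z a sa; rewrite (negbTE az) subr0.
Qed.

Section WeightSplitTheory.
Variables (K : fieldType) (W : lmodType K) (D : {linear W -> W}).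

Lemma split_weight s P Q m z v : weight_split D s P Q m -> z \in s ->
  weight D z (pact D (P z) v).
Proof. by move=> sp zs; exists m; apply: (split_exp sp). Qed.

Lemma weight_disjoint a b v : a != b -> weight D a v -> weight D b v -> v = 0.
Proof.
move=> ab [k vk] [l vl]; apply: (pact_coprimep _ vk vl).
exact: coprimep_XsubC_exp.
Qed.

Lemma weight_notin s P Q m a v : weight_split D s P Q m -> a \notin s ->
  weight D a v -> v = 0.
Proof.
move=> sp nsa va; rewrite -[v](split_sum sp) big_seq big1 // => z zs.
apply: (@weight_disjoint a z); last exact: (split_weight v sp zs).
  by apply: contraNneq nsa => ->.
exact: weight_pact.
Qed.

Lemma split_semisimple_weight s P Q m a v : weight_split D s P Q m ->
  weight D a v -> pact D Q v = a *: v.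
Proof.
move=> sp va; rewrite -{1 2}[v](split_sum sp) linear_sum scaler_sumr.
rewrite !big_seq; apply: eq_bigr => z zs /=.
have [->|az] := eqVneq a z; first exact: (split_semisimple sp v zs).
rewrite (weight_disjoint az (weight_pact _ va) (split_weight v sp zs)).
by rewrite linear0 scaler0.
Qed.

End WeightSplitTheory.

Lemma pact_intertwine (K : fieldType) (W1 W2 : lmodType K)
    (D1 : {linear W1 -> W1}) (D2 : {linear W2 -> W2})
    (T : {linear W1 -> W2}) p v :
  (forall v, D2 (T v) = T (D1 v)) -> pact D2 p (T v) = T (pact D1 p v).
Proof.
move=> com; rewrite /pact linear_sum; apply: eq_bigr => i _.
rewrite linearZ; congr (_ *: _).
by elim: (i : nat) => //= k ->; rewrite com.
Qed.

(** The first d + 1 powers of [f] are dependent in a space of dimension d, and the resulting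
    polynomial splits over a closed field. *)
Lemma lfun_annihilator (K : closedFieldType) (V : vectType K) (f : 'End(V)) :
  exists t : seq K, forall v, pact f (\prod_(z <- t) ('X - z%:P)) v = 0.
Proof.
pose d := \dim {:'End(V)}.
pose X := [tuple linfun (pact f 'X^i) | i < d.+1].
have /existsNP [k /not_implyP [kX /existsNP [i /eqP ki]]] :
    ~ (forall k : 'I_d.+1 -> K,
         \sum_(i < d.+1) k i *: X`_i = 0 -> forall i, k i = 0).
  move/freeP; rewrite /free size_tuple => /eqP dimX.
  by have := dimvS (subvf <<X>>); rewrite dimX ltnn.
pose p := \poly_(j < d.+1) k (inord j).
have p0 : p != 0.
  apply: contraNneq ki => p0.
  have <- : p`_i = k i by rewrite coef_poly ltn_ord inord_val.
  by rewrite p0 coef0.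
have pf v : pact f p v = 0.
  have := congr1 (fun g : 'End(V) => g v) kX.
  rewrite sum_lfunE lfunE /= => <-.
  rewrite /p poly_def pact_sum; apply: eq_bigr => j _.
  rewrite scale_lfunE (nth_map j) ?size_enum_ord // nth_ord_enum lfunE /=.
  by rewrite inord_val -mul_polyC pactM pactC.
have [t pt] := closed_field_poly_normal p.
exists t => v; apply: (pact_dvdp _ (pf v)).
by rewrite {1}pt dvdpZl ?lead_coef_eq0.
Qed.

(** * Multivariate polynomials and their directional derivatives *)

Lemma mpoly_alg_ind (n : nat) (K : comNzRingType) (P : {mpoly K[n]} -> Prop) :
  (forall c, P c%:MP) -> (forall i, P 'X_i) ->
  (forall p q, P p -> P q -> P (p + q)) ->
  (forall p q, P p -> P q -> P (p * q)) -> forall p, P p.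
Proof.
move=> PC PX PD PM; apply: mpolyind => [|c m p _ _ Pp]; first exact: (PC 0).
apply: PD => //; rewrite -mul_mpolyC; apply: (PM) => //; rewrite mpolyXE_id.
have P1 : P 1 by rewrite -mpolyC1.
apply: (big_ind P) => // i _.
by elim: (m i) => [|k IH]; rewrite ?expr0 // exprS; apply: PM.
Qed.

(* A name for the product of polynomials that can carry a bilinear structure. *)
Definition mpoly_mul (n : nat) (K : comNzRingType) (p q : {mpoly K[n]}) :=
  p * q.

Lemma mpoly_mul_is_bilinear n K :
  bilinear_for *:%R *:%R (@mpoly_mul n K).
Proof.
split=> [q|p] k u v; first by rewrite /mpoly_mul /= mulrDl scalerAl.
by rewrite /mpoly_mul /= mulrDr scalerAr.
Qed.

HB.instance Definition _ n (K : comNzRingType) :=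
  bilinear_isBilinear.Build K {mpoly K[n]} {mpoly K[n]} {mpoly K[n]}
    *:%R *:%R (@mpoly_mul n K) (@mpoly_mul_is_bilinear n K).

Lemma mderivXU (n : nat) (K : nzRingType) (i j : 'I_n) :
  ('X_j : {mpoly K[n]})^`M(i) = (i == j)%:R.
Proof.
rewrite mderivX mnm1E eq_sym; case: eqP => [->|_]; last by rewrite scale0r.
have -> : (U_(j) - U_(j))%MM = 0%MM :> 'X_{1.. n}.
  by apply/mnmP => k; rewrite mnmBE subnn mnm0E.
by rewrite mpolyX0 scale1r.
Qed.

Section DirectionalDerivative.
Variables (K : comNzRingType).

(** The differential of [p] at [v] in the direction [w], in the form that [lie_of_group] unfolds
    to. *)
Definition dirder n (p : {mpoly K[n]}) (v w : 'I_n -> K) : K :=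
  \sum_i (p^`M(i)).@[v] * w i.

Lemma dirderC n c (v w : 'I_n -> K) : dirder c%:MP v w = 0.
Proof. by rewrite /dirder big1 // => i _; rewrite mderivC meval0 mul0r. Qed.

Lemma dirderX n i (v w : 'I_n -> K) : dirder 'X_i v w = w i.
Proof.
rewrite /dirder (bigD1 i) //= mderivXU eqxx meval1 mul1r big1 ?addr0 // => j.
by rewrite mderivXU => /negbTE ->; rewrite meval0 mul0r.
Qed.

Lemma dirderD n p q (v w : 'I_n -> K) :
  dirder (p + q) v w = dirder p v w + dirder q v w.
Proof.
rewrite -big_split; apply: eq_bigr => i _.
by rewrite mderivD mevalD mulrDl.
Qed.

Lemma dirderM n p q (v w : 'I_n -> K) :
  dirder (p * q) v w = dirder p v w * q.@[v] + p.@[v] * dirder q v w.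
Proof.
rewrite /dirder mulr_suml mulr_sumr -big_split; apply: eq_bigr => i _ /=.
by rewrite mderivM mevalD !mevalM mulrDl mulrA mulrAC.
Qed.

(** The chain rule: both sides obey the same sum and product rules in [p], so constants and
    variables suffice. *)
Lemma dirder_comp n k (lq : n.-tuple {mpoly K[k]}) p (v w : 'I_k -> K) :
  dirder (p \mPo lq) v w =
  dirder p (fun i => (tnth lq i).@[v]) (fun i => dirder (tnth lq i) v w).
Proof.
elim/mpoly_alg_ind: p => [c|i|p q IHp IHq|p q IHp IHq].
- by rewrite comp_mpolyC !dirderC.
- by rewrite comp_mpolyXU dirderX (tnth_nth 0).
- by rewrite comp_mpolyD !dirderD IHp IHq.
- by rewrite rmorphM /= !dirderM IHp IHq !comp_mpoly_meval.
Qed.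

Lemma eq_dirder n p (v v' w w' : 'I_n -> K) :
  v =1 v' -> w =1 w' -> dirder p v w = dirder p v' w'.
Proof.
move=> vv' ww'; apply: eq_bigr => i _; rewrite ww'; congr (_ * _).
exact: meval_eq.
Qed.

Lemma dirder_linearr n p (v w w' : 'I_n -> K) a :
  dirder p v (fun i => a * w i + w' i) = a * dirder p v w + dirder p v w'.
Proof.
rewrite /dirder mulr_sumr -big_split; apply: eq_bigr => i _ /=.
by rewrite mulrDr mulrCA.
Qed.

End DirectionalDerivative.

(** * Derivations of the polynomials on End(V) given by right translation *)

Section RightTranslation.
Variables (K : fieldType) (V : vectType K).
Local Notation E := 'End(V).
Local Notation e j := ((vbasis {:E})`_j).
Local Notation n := (\dim {:E}).

Lemma end_coordP (a : E) : a = \sum_(j < n) end_coord a j *: e j.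
Proof. exact: coord_vbasis (memvf a). Qed.

Lemma end_coord_linear k (a b : E) i :
  end_coord (k *: a + b) i = k * end_coord a i + end_coord b i.
Proof. by rewrite /end_coord linearP. Qed.

Definition lcomp (X Y : E) : E := (X \o Y)%VF.

Lemma lcomp_is_linear X : linear (lcomp X).
Proof. by move=> k a b; rewrite /lcomp comp_lfunDr comp_lfunZr. Qed.

HB.instance Definition _ X :=
  GRing.isLinear.Build K E E *:%R (lcomp X) (@lcomp_is_linear X).

Definition rcomp (Y X : E) : E := (X \o Y)%VF.

Lemma rcomp_is_linear Y : linear (rcomp Y).
Proof. by move=> k a b; rewrite /rcomp comp_lfunDl comp_lfunZl. Qed.

HB.instance Definition _ Y :=
  GRing.isLinear.Build K E E *:%R (rcomp Y) (@rcomp_is_linear Y).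

Definition lfun_eval (v : V) (X : E) : V := X v.

Lemma lfun_eval_is_linear v : linear (lfun_eval v).
Proof. by move=> k X Y; rewrite /lfun_eval add_lfunE scale_lfunE. Qed.

HB.instance Definition _ v :=
  GRing.isLinear.Build K E V *:%R (lfun_eval v) (@lfun_eval_is_linear v).

Lemma pact_lcomp X p Y v : pact (lcomp X) p Y v = pact X p (Y v).
Proof.
rewrite -[LHS]/(lfun_eval v _) -(@pact_intertwine _ _ _ _ X) // => Z.
exact/esym/comp_lfunE.
Qed.

(** For linear [f], the i-th coordinate of [f] as a linear form, so that [f] can be substituted into
    polynomials. *)
Definition linpoly (f : E -> E) (i : 'I_n) : end_poly V :=
  \sum_(j < n) end_coord (f (e j)) i *: 'X_j.

Lemma linpoly_eval (f : {linear E -> E}) i b :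
  (linpoly f i).@[end_coord b] = end_coord (f b) i.
Proof.
rewrite {2}[b]end_coordP linear_sum /end_coord linear_sum /=.
rewrite /linpoly raddf_sum; apply: eq_bigr => j _ /=.
by rewrite mevalZ mevalXU !linearZ /= mulrC.
Qed.

Lemma linpoly_dirder (f : {linear E -> E}) i v b :
  dirder (linpoly f i) v (end_coord b) = end_coord (f b) i.
Proof.
rewrite {2}[b]end_coordP linear_sum /end_coord linear_sum /=.
have -> : dirder (linpoly f i) v (fun i => coord (vbasis {:E}) i b)
   = \sum_(j < n) end_coord (f (e j)) i * end_coord b j.
  rewrite /linpoly; elim/big_ind2: _ => [|p x q y IHp IHq|j _].
  - by rewrite -mpolyC0 dirderC.
  - by rewrite dirderD IHp IHq.
  - by rewrite -mul_mpolyC dirderM dirderC mul0r add0r mevalC dirderX.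
by apply: eq_bigr => j _; rewrite !linearZ /= mulrC.
Qed.

(* (rderiv X p)(a) is the derivative at a of p in the direction a X.          *)
Definition rderiv (X : E) (p : end_poly V) : end_poly V :=
  \sum_i p^`M(i) * linpoly (rcomp X) i.

Lemma rderiv_is_linear X : linear (rderiv X).
Proof.
move=> k p q; rewrite /rderiv scaler_sumr -big_split; apply: eq_bigr => i _.
by rewrite linearP mulrDl scalerAl.
Qed.

HB.instance Definition _ X :=
  GRing.isLinear.Build K (end_poly V) (end_poly V) *:%R (rderiv X)
    (@rderiv_is_linear X).

Lemma rderivM X p q : rderiv X (p * q) = rderiv X p * q + p * rderiv X q.
Proof.
rewrite /rderiv mulr_suml mulr_sumr -big_split; apply: eq_bigr => i _ /=.
by rewrite mderivM mulrDl mulrAC mulrA.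
Qed.

Lemma rderivC X c : rderiv X c%:MP = 0.
Proof. by rewrite /rderiv big1 // => i _; rewrite mderivC mul0r. Qed.

Lemma rderivX X i : rderiv X 'X_i = linpoly (rcomp X) i.
Proof.
rewrite /rderiv (bigD1 i) //= mderivXU eqxx mul1r big1 ?addr0 // => j.
by rewrite mderivXU => /negbTE ->; rewrite mul0r.
Qed.

Lemma rderiv_eval X p a :
  (rderiv X p).@[end_coord a] = dirder p (end_coord a) (end_coord (a \o X)%VF).
Proof.
rewrite /rderiv raddf_sum; apply: eq_bigr => i _ /=.
by rewrite mevalM (linpoly_eval (rcomp X)).
Qed.

(* The i-th coordinate function of a Y, as a polynomial in a.                 *)
Definition rlin i (Y : E) : end_poly V := linpoly (rcomp Y) i.

Lemma rlin_is_linear i : linear (rlin i).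
Proof.
move=> k Y Z; rewrite /rlin /linpoly scaler_sumr -big_split.
apply: eq_bigr => j _ /=.
have -> : rcomp (k *: Y + Z) (e j) = k *: rcomp Y (e j) + rcomp Z (e j).
  exact: lcomp_is_linear.
by rewrite end_coord_linear scalerDl scalerA.
Qed.

HB.instance Definition _ i :=
  GRing.isLinear.Build K E (end_poly V) *:%R (rlin i) (@rlin_is_linear i).

Lemma rlin1 i : rlin i \1%VF = 'X_i.
Proof.
rewrite /rlin /linpoly (bigD1 i) //= big1 ?addr0 => [|j ji].
  rewrite /rcomp comp_lfun1r /end_coord coord_free ?eqxx ?scale1r //.
  exact: basis_free (vbasisP _).
rewrite /rcomp comp_lfun1r /end_coord coord_free ?(negbTE ji) ?scale0r //.
exact: basis_free (vbasisP _).
Qed.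

(** The map a -> a Y has derivative a X Y in the direction a X. Hence [rlin i] intertwines left
    multiplication by [X] with [rderiv X] and carries weights of the former to weights of the
    latter. *)
Lemma rderiv_rlin X Y i : rderiv X (rlin i Y) = rlin i (lcomp X Y).
Proof.
rewrite /rlin {1}/linpoly linear_sum /=.
under eq_bigr do rewrite linearZ /= rderivX scaler_sumr.
rewrite exchange_big; apply: eq_bigr => k _ /=.
under eq_bigr do rewrite scalerA.
rewrite -scaler_suml; congr (_ *: _).
rewrite /rcomp /lcomp comp_lfunA.
rewrite -[(_ \o Y)%VF]/(rcomp Y _) [X in rcomp Y X]end_coordP linear_sum.
rewrite /end_coord linear_sum; apply: eq_bigr => j _.
by rewrite !linearZ /= mulrC.
Qed.

End RightTranslation.

(** * Chevalley's theorem: Lie(G) contains semisimple parts *)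

Section JordanComponents.
Variables (K : closedFieldType) (V : vectType K).
Local Notation E := 'End(V).
Variables (G : E -> Prop) (X : E).
Hypotheses (G_alg : algebraic_group G) (X_lie : lie_of_group G X).

Definition vanishes_on (p : end_poly V) :=
  forall a, G a -> p.@[end_coord a] = 0.

(** For a in [G] the translate q(b) = p(a b) vanishes on [G]. By the chain rule its derivative at 1
    along [X] is that of [p] at a along a X. *)
Lemma vanishes_rderiv p : vanishes_on p -> vanishes_on (rderiv X p).
Proof.
move=> p0 a Ga; rewrite rderiv_eval.
pose q := p \mPo [tuple linpoly (lcomp a) i | i < \dim {:E}].
have q0 : vanishes_on q.
  move=> b Gb; rewrite /q comp_mpoly_meval.
  have [_ _ GM _] := G_alg; rewrite -(p0 _ (GM _ _ Ga Gb)).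
  by apply: meval_eq => i; rewrite tnth_mktuple linpoly_eval.
have := X_lie q0; rewrite -/(dirder q _ (end_coord X)) dirder_comp => <-.
apply: eq_dirder => i; rewrite tnth_mktuple.
  by rewrite linpoly_eval /= /lcomp comp_lfun1r.
by rewrite linpoly_dirder.
Qed.

Lemma vanishes_pact Q p : vanishes_on p -> vanishes_on (pact (rderiv X) Q p).
Proof.
move=> p0 a Ga; rewrite /pact raddf_sum big1 //= => i _; rewrite mevalZ.
have -> : (iter i (rderiv X) p).@[end_coord a] = 0; last by rewrite mulr0.
by move: a Ga; elim: (i : nat) => //= k IH; apply: vanishes_rderiv.
Qed.

Section SemisimplePart.
Variable S : E.

Inductive weight_sum : end_poly V -> Prop :=
| weight_sum0 : weight_sum 0
| weight_sum_add a p q : rderiv S p = a *: p -> weight (rderiv X) a p ->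
    weight_sum q -> weight_sum (p + q).

Lemma weight_sumD p q : weight_sum p -> weight_sum q -> weight_sum (p + q).
Proof.
move=> + qs; elim=> [|a p1 p2 Sp Xp _ IH]; first by rewrite add0r.
by rewrite -addrA; exact: weight_sum_add Sp Xp IH.
Qed.

(** Eigenvalues add under products, for [rderiv S] by the Leibniz rule and for [rderiv X] by
    [weight_mul]. *)
Lemma weight_sumM p q : weight_sum p -> weight_sum q -> weight_sum (p * q).
Proof.
move=> ps qs; elim: ps => [|a p1 p2 Sp Xp _ IH].
  by rewrite mul0r; apply: weight_sum0.
rewrite mulrDl; apply: weight_sumD IH.
elim: qs => [|b q1 q2 Sq Xq _ IH]; first by rewrite mulr0; apply: weight_sum0.
rewrite mulrDr; apply: (@weight_sum_add (a + b)) IH.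
  by rewrite rderivM Sp Sq scalerDl scalerAl scalerAr.
apply: (@weight_mul _ _ _ _ _ _ (rderiv X) (@mpoly_mul _ K)) Xp Xq.
exact: rderivM.
Qed.

Lemma weight_sum_pact p : weight_sum p ->
  exists Q, pact (rderiv X) Q p = rderiv S p.
Proof.
(* The claim is strengthened to every [Q] with prescribed residues, so that a new summand only
   enlarges the list and the exponent. *)
move=> ps; suff [l [m H]] : exists (l : seq K) m, forall Q : {poly K},
    (forall z, z \in l -> ('X - z%:P) ^+ m %| Q - z%:P) ->
    pact (rderiv X) Q p = rderiv S p.
  by have [Q /H] := poly_chinese l m (fun z => z%:P); exists Q.
elim: ps => [|a p1 p2 Sp [k Xp] _ [l [m IH]]].
  by exists [::], 0%N => Q _; rewrite !linear0.
exists (a :: l), (maxn k m) => Q hQ; rewrite !linearD /= IH; last first.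
  move=> z zl; apply: dvdp_trans (hQ z _); last by rewrite inE zl orbT.
  by rewrite dvdp_exp2l // leq_maxr.
congr (_ + _); rewrite Sp -(pactC (rderiv X)).
apply/eqP; rewrite -subr_eq0 -pactN -pactD; apply/eqP.
apply: pact_dvdp Xp; apply: dvdp_trans (hQ a (mem_head _ _)).
by rewrite dvdp_exp2l // leq_maxl.
Qed.

End SemisimplePart.

Lemma lie_of_group_semisimple s P Q m : weight_split (lcomp X) s P Q m ->
  lie_of_group G (pact (lcomp X) Q \1%VF).
Proof.
move=> sp; set S := pact _ _ _.
have S_comp z v : z \in s ->
    lcomp S (pact (lcomp X) (P z) v) = z *: pact (lcomp X) (P z) v.
  move=> zs; rewrite -(split_semisimple sp) //; apply/lfunP => u.
  by rewrite comp_lfunE !pact_lcomp id_lfunE.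
have all_sums p : weight_sum S p.
  elim/mpoly_alg_ind: p => [c|i|p q|p q].
  - rewrite -[c%:MP]addr0; apply: (@weight_sum_add _ 0); last exact: weight_sum0.
      by rewrite rderivC scale0r.
    by exists 1%N; rewrite expr1 pactXsubC /= rderivC scale0r subr0.
  (* The coordinate ['X_i] comes from the identity, which is the sum of the [P z] evaluated at [X];
     the z-th summand has weight [z] for both derivations. *)
  - rewrite -rlin1 -(split_sum sp \1%VF) linear_sum big_seq.
    apply: (big_ind (weight_sum S)) => [||z zs /=].
    + exact: weight_sum0.
    + exact: weight_sumD.
    rewrite -[rlin _ _]addr0; apply: (@weight_sum_add _ z); last exact: weight_sum0.
      by rewrite rderiv_rlin S_comp // linearZ.
    exists m; rewrite (@pact_intertwine _ _ _ (lcomp X)); last first.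
      by move=> Y; rewrite /= rderiv_rlin.
    by rewrite (split_exp sp) // linear0.
  - exact: weight_sumD.
  - exact: weight_sumM.
(* [rderiv S p] is a polynomial in [rderiv X] applied to [p], so it vanishes on [G]; its value at 1
   is the derivative of [p] along [S]. *)
move=> p p0; have [R pR] := weight_sum_pact (all_sums p).
have [_ G1 _ _] := G_alg.
have := vanishes_pact R p0 G1; rewrite pR rderiv_eval comp_lfun1l.
by [].
Qed.

End JordanComponents.

(** * The nilpotent part: membership in the algebraic hull, and nilpotency *)

Lemma lie_of_group_linear (K : fieldType) (V : vectType K)
    (G : 'End(V) -> Prop) k X Y :
  lie_of_group G X -> lie_of_group G Y -> lie_of_group G (k *: X + Y).
Proof.
move=> GX GY p p0; rewrite -/(dirder p _ (end_coord (k *: X + Y))).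
rewrite (@eq_dirder _ _ _ _ (end_coord \1%VF) _
  (fun i => k * end_coord X i + end_coord Y i)) //; last first.
  by move=> i; rewrite end_coord_linear.
by rewrite dirder_linearr [dirder _ _ _]GX // [dirder _ _ _]GY // mulr0 addr0.
Qed.

Lemma algebraic_hull_nilpotent_part (K : closedFieldType) (V : vectType K)
    (A : 'End(V) -> Prop) X s P Q m :
  A X -> weight_split (lcomp X) s P Q m ->
  algebraic_hull A (X - pact (lcomp X) Q \1%VF).
Proof.
move=> AX sp h [G G_alg hG] Ah; apply/hG.
have GX : lie_of_group G X by apply/hG/Ah.
rewrite addrC -scaleN1r; apply: lie_of_group_linear => //.
exact: lie_of_group_semisimple sp.
Qed.

Lemma lfun_weight_split (K : closedFieldType) (V : vectType K) (X : 'End(V)) :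
  exists s P Q m, weight_split (lcomp X) s P Q m /\ weight_split X s P Q m.
Proof.
have [t Xt] := lfun_annihilator X.
have [s [P [Q [m split]]]] := weight_split_exists t.
exists s, P, Q, m; split; last exact: split.
by apply: split => Y; apply/lfunP => v; rewrite pact_lcomp Xt zero_lfunE.
Qed.

(** On the generalised eigenspace for [z] the difference is [X - z], and its m-th power kills the
    component given by [P z]. *)
Lemma nilpotent_part (K : closedFieldType) (V : vectType K) (X : 'End(V))
    s P Q m :
  weight_split X s P Q m -> nilpotent_end (X - pact (lcomp X) Q \1%VF).
Proof.
move=> sp; set N := _ - _; exists m => v.
rewrite -[v](split_sum sp) big_seq.
rewrite (big_morph (iter m N) (id1 := 0) (op1 := +%R)); first last.
- by elim: (m) => //= k ->; rewrite linear0.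
- by move=> u w; elim: (m) => //= k ->; rewrite linearD.
rewrite big1 // => z zs; move: (split_exp sp v zs) (split_weight v sp zs).
elim: (m) (pact X (P z) v) => [|k IH] u; first by rewrite expr0 pact1.
rewrite exprSr pactM iterSr pactXsubC => uk uz.
have -> : N u = X u - z *: u.
  rewrite /N add_lfunE opp_lfunE pact_lcomp id_lfunE.
  by rewrite (split_semisimple_weight sp uz).
by apply: IH => //; rewrite -pactXsubC; apply: weight_pact.
Qed.

(** * Weights of [ad br x] and nil-invariant forms *)

Section NilInvariantForms.
Variables (K : numClosedFieldType) (g : vectType K).
Variables (br : {bilinear g -> g -> g}) (B : {biscalar g}).
Hypothesis br_lie : is_lie_bracket br.

Lemma adE x y : ad br x y = br x y.
Proof. exact: lfunE. Qed.

Lemma lie_anticomm x y : br x y = - br y x.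
Proof.
have [alt _] := br_lie; apply/eqP; rewrite -addr_eq0; apply/eqP.
by have := alt (x + y); rewrite linearDl !linearDr /= !alt add0r addr0.
Qed.

Lemma ad_derivation x u v :
  ad br x (br u v) = br (ad br x u) v + br u (ad br x v).
Proof.
have [_ jac] := br_lie; rewrite !adE; apply/eqP; rewrite -subr_eq0 opprD.
rewrite -(jac x u v) [br v x]lie_anticomm linearNr [br v _]lie_anticomm /=.
by rewrite -!addrA [- br u _ + _]addrC.
Qed.

Lemma weight_bracket x a b u v : weight (ad br x) a u -> weight (ad br x) b v ->
  weight (ad br x) (a + b) (br u v).
Proof. by apply: weight_mul => w w'; apply: ad_derivation. Qed.

(** [ad br y] shifts weights by [a]. In characteristic 0 the values z + k a for k from 0 to [size s]
    are distinct, so one of them lies outside [s] and its weight space is zero. *)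
Lemma ad_weight_nilpotent x a y : a != 0 -> weight (ad br x) a y ->
  nilpotent_end (ad br y).
Proof.
move=> a0 ya; have [s [P [Q [m [_ sp]]]]] := lfun_weight_split (ad br x).
exists (size s) => v; rewrite -[v](split_sum sp) big_seq.
rewrite (big_morph (iter (size s) (ad br y)) (id1 := 0) (op1 := +%R)); first last.
- by elim: (size s) => //= k ->; rewrite linear0.
- by move=> u w; elim: (size s) => //= k ->; rewrite linearD.
rewrite big1 // => z zs; set u := pact _ _ _.
have uk k : weight (ad br x) (z + a *+ k) (iter k (ad br y) u).
  elim: k => [|k IH]; first by rewrite addr0; apply: (split_weight v sp zs).
  by rewrite mulrS addrCA /= adE; apply: weight_bracket.
have [k ks kns] : exists2 k, (k <= size s)%N & z + a *+ k \notin s.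
  apply: contrapT => no.
  have sub : {subset [seq z + a *+ k | k <- iota 0 (size s).+1] <= s}.
    move=> w /mapP [k]; rewrite mem_iota /= add0n ltnS => ks ->.
    by apply: contrapT => /negP kns; apply: no; exists k.
  have := uniq_leq_size _ sub; rewrite size_map size_iota ltnn.
  suff U : uniq [seq z + a *+ k | k <- iota 0 (size s).+1] by move/(_ U).
  rewrite map_inj_uniq ?iota_uniq // => i j /addrI /eqP.
  rewrite -[a *+ i]mulr_natr -[a *+ j]mulr_natr (inj_eq (mulfI a0)).
  by rewrite Num.Theory.eqr_nat => /eqP.
rewrite -(subnK ks) iterD (weight_notin sp kns (uk k)).
by elim: (size s - k)%N => //= j ->; rewrite linear0.
Qed.

Hypotheses (B_sym : is_symmetric_form B) (B_nil : is_nil_invariant br B).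

Lemma skew_weight x a y u v : a != 0 -> weight (ad br x) a y ->
  B (br y u) v = - B u (br y v).
Proof.
move=> a0 ya; rewrite -!adE; apply: B_nil (ad_weight_nilpotent a0 ya) _ _.
by move=> h _; apply; exists y.
Qed.

(** With v = [x, w], skewness of ad w on the pair (x, x) and symmetry give 2 B(x, v) = 0. *)
Lemma form_self_weight x a v : a != 0 -> weight (ad br x) a v -> B x v = 0.
Proof.
move=> a0 /(weight_invertible a0) [w wa ->]; rewrite /= adE.
have := skew_weight x x a0 wa.
rewrite [br w x]lie_anticomm linearNl linearNr /=.
rewrite opprK B_sym => /eqP.
rewrite eq_sym -addr_eq0 -mulr2n Num.Theory.mulrn_eq0 /=.
by move/eqP.
Qed.

Lemma form_weight x a b u v : a + b != 0 ->
  weight (ad br x) a u -> weight (ad br x) b v -> B u v = 0.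
Proof.
(* As a + b is nonzero, so is [a] or [b]; symmetry of [B] exchanges them. *)
move=> ab0; wlog a0 : a b u v ab0 / a != 0 => [IH ua vb|].
  have [a0|a0] := eqVneq a 0; last exact: IH ua vb.
  rewrite B_sym; apply: (IH b a) => //; first by rewrite addrC.
  by move: ab0; rewrite a0 add0r.
move=> /(weight_invertible a0) [w wa ->] vb.
rewrite /= adE lie_anticomm linearNl /= (skew_weight _ _ a0 wa) opprK.
exact: form_self_weight ab0 (weight_bracket wa vb).
Qed.

Lemma nil_invariant_form_invariant : is_invariant_form br B.
Proof.
move=> x y z; have [s [P [Q [m [spl sp]]]]] := lfun_weight_split (ad br x).
set N := ad br x - pact (lcomp (ad br x)) Q \1%VF.
have N_skew u v : B (N u) v = - B u (N v).
  apply: B_nil (nilpotent_part sp) _ _.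
  by apply: algebraic_hull_nilpotent_part spl; exists x.
have brE a u : weight (ad br x) a u -> br x u = N u + a *: u.
  move=> ua; rewrite /N add_lfunE opp_lfunE pact_lcomp id_lfunE adE.
  by rewrite (split_semisimple_weight sp ua) subrK.
rewrite -[y](split_sum sp) -[z](split_sum sp) !linear_sumr /=.
rewrite -sumrN big_seq [RHS]big_seq; apply: eq_bigr => b sb.
rewrite !linear_sumlz -sumrN big_seq [RHS]big_seq; apply: eq_bigr => a sa /=.
have ua := split_weight y sp sa; have vb := split_weight z sp sb.
rewrite (brE _ _ ua) (brE _ _ vb) linearDl linearDr linearZl_LR linearZr_LR /=.
rewrite N_skew opprD; congr (_ + _).
(* The scalar parts remain: a B(u, v) = - b B(u, v), either because a + b = 0 or because u and v are
   orthogonal. *)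
have [ab0|ab0] := eqVneq (a + b) 0; last first.
  by rewrite (form_weight ab0 ua vb) !mulr0 oppr0.
by rewrite -mulNr; congr (_ * _); apply/eqP; rewrite -addr_eq0 ab0.
Qed.

End NilInvariantForms.

Local Open Scope complex_scope.

Theorem corollaryB (R : realType) (g : vectType R[i])
    (br : {bilinear g -> g -> g}) (B : {biscalar g})
    (br_lie : is_lie_bracket br) (B_sym : is_symmetric_form B)
    (B_nil : is_nil_invariant br B) :
  is_invariant_form br B.
Proof. exact: nil_invariant_form_invariant. Qed.
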